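(* Let $a>b>0$ and $x_0,y_0$ be real numbers, let $\Gamma:\ (x-x_0)^2+(y-y_0)^2=1$, and let $\mathcal{C}(t):\ \frac{x^2}{a-t}+\frac{y^2}{b-t}=1$. Then each non-degenerate conic $\mathcal{C}(t)$ (i.e. $\mathcal{C}(t)$ for each $t\notin\{a,b\}$) is $6$-Poncelet inscribed in $\Gamma$ if and only if one of the two focal points $(\pm\sqrt{a-b},0)$ belongs to $\Gamma$ and the other one is the centre of $\Gamma$.
   Context: The parameter $t$ ranges over $\mathbb{C}$; $\mathcal{C}(t)$ is a non-degenerate conic for $t\notin\{a,b\}$. For an integer $n\ge 3$, $\Gamma$ and $\mathcal{C}(t)$ are an $n$-Poncelet pair (also: $\mathcal{C}(t)$ is $n$-Poncelet inscribed in $\Gamma$) if there is a closed polygonal line with $n$ sides inscribed in $\Gamma$ (vertices on $\Gamma$) and circumscribed about $\mathcal{C}(t)$ (lines containing the sides are tangent to $\mathcal{C}(t)$). As usual for Poncelet's theorem, this is understood in the complexified projective plane: consecutive vertices are the two intersections of a side with $\Gamma$, and consecutive sides are the two tangents from a vertex to $\mathcal{C}(t)$, both counted with multiplicity; the trivial polygon sitting at a point of tangency of the two conics is not counted. For $t\notin\{a,b\}$ this is equivalent to Cayley's condition $p_n(t)=0$, where, with $$D_t(\lambda)=(a-t)(b-t)\det(\mathcal{C}(t)+\lambda\Gamma),\quad \Gamma=\begin{pmatrix}1&0&-x_0\\0&1&-y_0\\-x_0&-y_0&x_0^2+y_0^2-1\end{pmatrix},\quad \mathcal{C}(t)=\mathrm{diag}\left(\tfrac1{a-t},\tfrac1{b-t},-1\right),$$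 and $\sqrt{D_t(\lambda)}=\sum_{k\ge0}C_k(t)\lambda^k$ the Taylor series at $\lambda=0$, one puts $p_{2m+1}(t)=\det(C_{i+j}(t))_{1\le i,j\le m}$ and $p_{2m+2}(t)=\det(C_{i+j+1}(t))_{1\le i,j\le m}$ for $m\ge1$. *)

(* Defs.v *)
From mathcomp Require Import all_boot all_order all_algebra.
From mathcomp Require Import reals complex ring.

Set Implicit Arguments.
Unset Strict Implicit.
Unset Printing Implicit Defensive.

Import GRing.Theory.
Local Open Scope ring_scope.

(* Points and lines of the projective plane over [K] are both represented by
   non-zero vectors in ['cV[K]_3], up to a non-zero scalar; a conic is
   represented by its symmetric 3 x 3 matrix. *)
Section Conics.
Variable K : fieldType.
Implicit Types (M G C : 'M[K]_3) (X Y l m : 'cV[K]_3).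

Definition proj_eq X Y : Prop := exists2 k : K, k != 0 & X = k *: Y.

Definition incident X l : Prop := l^T *m X = 0.

Definition on_conic M X : Prop := X^T *m M *m X = 0.

(* [M *m X] is the polar line of [X]. *)
Definition tangent_at M l X : Prop :=
  [/\ X != 0, on_conic M X & proj_eq l (M *m X)].

Definition tangent M l : Prop := exists X, tangent_at M l X.

(* [X] and [Y] are the two intersections of the line [l] with the conic [M],
   counted with multiplicity. *)
Definition line_meets M l X Y : Prop :=
  [/\ on_conic M X, on_conic M Y, incident X l, incident Y l
    & proj_eq X Y -> tangent_at M l X].

(* [l] and [m] are the two tangents from the point [X] to the conic [M],
   counted with multiplicity: they coincide only when [X] lies on [M], in which
   case both are the tangent at [X]. *)
Definition tangents_from M X l m : Prop :=
  [/\ tangent M l, tangent M m, incident X l, incident X m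
    & proj_eq l m -> tangent_at M l X].

Definition tangency_point G C X : Prop :=
  exists l, tangent_at G l X /\ tangent_at C l X.

(* Side [l i] joins the vertices [P i] and [P (i + 1)], indices modulo [n]. *)
Definition poncelet_polygon n G C (P l : 'I_n -> 'cV[K]_3) : Prop :=
  [/\ forall i, P i != 0,
      forall i, l i != 0,
      forall i, line_meets G (l i) (P i) (P (ordS i))
    & forall i, tangents_from C (P (ordS i)) (l i) (l (ordS i))].

(* The excluded case is the trivial polygon sitting at a point where the two
   conics are tangent to each other. *)
Definition poncelet_pair n G C : Prop :=
  exists P l : 'I_n -> 'cV[K]_3,
    poncelet_polygon G C P l /\
    ~ (exists2 X, tangency_point G C X & forall i, proj_eq (P i) X).

Definition affine_point (x y : K) : 'cV[K]_3 := \col_i [:: x; y; 1]`_i.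

Definition unit_circle (x0 y0 : K) : 'M[K]_3 :=
  \matrix_(i, j)
    (nth [::] [:: [:: 1; 0; - x0];
                  [:: 0; 1; - y0];
                  [:: - x0; - y0; x0 ^+ 2 + y0 ^+ 2 - 1]] i)`_j.

Definition confocal_conic (a b t : K) : 'M[K]_3 :=
  diag_mx (\row_i [:: (a - t)^-1; (b - t)^-1; -1]`_i).

Lemma on_unit_circleE x0 y0 x y :
  on_conic (unit_circle x0 y0) (affine_point x y) <->
  (x - x0) ^+ 2 + (y - y0) ^+ 2 = 1.
Proof.
rewrite /on_conic; set q := _ *m _.
have -> : q = ((x - x0) ^+ 2 + (y - y0) ^+ 2 - 1)%:M.
  apply/matrixP=> i j; rewrite !ord1 !mxE !big_ord_recl big_ord0 !mxE /=.
  rewrite !big_ord_recl !big_ord0 !mxE /=.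
  by ring.
split=> [/matrixP/(_ 0 0)|->]; last by rewrite subrr raddf0.
by rewrite !mxE eqxx mulr1n => /eqP; rewrite subr_eq0 => /eqP.
Qed.

Lemma on_confocal_conicE a b t x y :
  on_conic (confocal_conic a b t) (affine_point x y) <->
  x ^+ 2 / (a - t) + y ^+ 2 / (b - t) = 1.
Proof.
rewrite /on_conic; set q := _ *m _.
have -> : q = (x ^+ 2 / (a - t) + y ^+ 2 / (b - t) - 1)%:M.
  apply/matrixP=> i j; rewrite !ord1 !mxE !big_ord_recl big_ord0 !mxE /=.
  rewrite !big_ord_recl !big_ord0 !mxE /=.
  by ring.
split=> [/matrixP/(_ 0 0)|->]; last by rewrite subrr raddf0.
by rewrite !mxE eqxx mulr1n => /eqP; rewrite subr_eq0 => /eqP.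
Qed.

End Conics.

(* Main.v *)
(* Write D for the matrix of the dual conic, G for that of the circle, L = 2 D G - tr(D G)
   and KK = G L. For a Poncelet polygon, the line joining the two neighbours of a vertex P
   is KK P, so the two triangles formed by every second vertex of a hexagon are inscribed
   in G and circumscribed about the conic with dual matrix S = KK^-1 G KK^-1. A triangle
   inscribed in G and circumscribed about S exists only if 2 tr((S G)^2) = tr(S G)^2; since
   S G = L^-2, the Cayley-Hamilton theorem turns this into a condition on the coefficients
   of the characteristic polynomial of L, which all happen to be linear in t. The condition
   equates to zero the product of a non-constant linear polynomial and a cubic in t; the
   vanishing of the four coefficients of the cubic determines a - b, y0 and, up to sign,
   x0.
   Conversely, when one focus lies on the circle and the other is its centre, the isotropic
   lines through the foci form a hexagon which serves all the conics at once. *)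
Require Import Defs.
From mathcomp Require Import all_boot all_order all_algebra.
From mathcomp Require Import reals complex ring lra.

Set Implicit Arguments.
Unset Strict Implicit.
Unset Printing Implicit Defensive.

Import Order.TTheory GRing.Theory Num.Theory.
Local Open Scope ring_scope.
Local Open Scope complex_scope.

(** * Coordinates, incidence and polarity in the projective plane *)

Section Coordinates.
Variable K : fieldType.
Implicit Types (M : 'M[K]_3) (X Y Z l m : 'cV[K]_3).

Definition mx3 (a b c d e f g h i : K) : 'M[K]_3 :=
  \matrix_(r, s) (nth [::] [:: [:: a; b; c]; [:: d; e; f]; [:: g; h; i]] r)`_s.

Definition cv3 (x y z : K) : 'cV[K]_3 := \col_r [:: x; y; z]`_r.

Definition dot X Y : K := (X^T *m Y) 0 0.

Definition cross X Y : 'cV[K]_3 :=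
  cv3 (X 1 0 * Y 2%:R 0 - X 2%:R 0 * Y 1 0) (X 2%:R 0 * Y 0 0 - X 0 0 * Y 2%:R 0)
      (X 0 0 * Y 1 0 - X 1 0 * Y 0 0).

Definition col3 X Y Z : 'M[K]_3 :=
  mx3 (X 0 0) (Y 0 0) (Z 0 0) (X 1 0) (Y 1 0) (Z 1 0)
      (X 2%:R 0) (Y 2%:R 0) (Z 2%:R 0).

Lemma ord3P (P : 'I_3 -> Prop) : P 0 -> P 1 -> P 2%:R -> forall i, P i.
Proof.
move=> P0 P1 P2 [[|[|[|i]]] lti] //.
- by rewrite (_ : Ordinal lti = 0) //; apply: val_inj.
- by rewrite (_ : Ordinal lti = 1) //; apply: val_inj.
- by rewrite (_ : Ordinal lti = 2%:R) //; apply: val_inj.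
Qed.

Lemma sum3 (F : 'I_3 -> K) : \sum_i F i = F 0 + F 1 + F 2%:R.
Proof.
rewrite !big_ord_recl big_ord0 addr0 addrA.
by congr (_ + F _ + F _); apply: val_inj.
Qed.

Lemma cv3_eta X : X = cv3 (X 0 0) (X 1 0) (X 2%:R 0).
Proof. by apply/colP; apply: ord3P; rewrite !mxE. Qed.

Lemma mx3_eta M : M = mx3 (M 0 0) (M 0 1) (M 0 2%:R) (M 1 0) (M 1 1) (M 1 2%:R)
  (M 2%:R 0) (M 2%:R 1) (M 2%:R 2%:R).
Proof. by apply/matrixP; apply: ord3P; apply: ord3P; rewrite !mxE. Qed.

Lemma cv3P X : exists x y z, X = cv3 x y z.
Proof. by do 3 eexists; exact: cv3_eta. Qed.

Lemma cv3E x y z :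
  ((cv3 x y z 0 0 = x) * (cv3 x y z 1 0 = y) * (cv3 x y z 2%:R 0 = z))%type.
Proof. by rewrite !mxE. Qed.

Lemma cv3_inj x y z x' y' z' :
  cv3 x y z = cv3 x' y' z' -> [/\ x = x', y = y' & z = z'].
Proof.
by move=> /colP e; move: (e 0) (e 1) (e 2%:R); rewrite !mxE.
Qed.

Lemma cv30 : cv3 0 0 0 = 0.
Proof. by apply/colP; apply: ord3P; rewrite !mxE. Qed.

Lemma mx3_mul a b c d e f g h i a' b' c' d' e' f' g' h' i' :
  mx3 a b c d e f g h i *m mx3 a' b' c' d' e' f' g' h' i' =
  mx3 (a * a' + b * d' + c * g') (a * b' + b * e' + c * h')
        (a * c' + b * f' + c * i')
      (d * a' + e * d' + f * g') (d * b' + e * e' + f * h')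
        (d * c' + e * f' + f * i')
      (g * a' + h * d' + i * g') (g * b' + h * e' + i * h')
        (g * c' + h * f' + i * i').
Proof.
by apply/matrixP; apply: ord3P; apply: ord3P; rewrite !mxE sum3 !mxE.
Qed.

Lemma mx3_mulv a b c d e f g h i x y z :
  mx3 a b c d e f g h i *m cv3 x y z =
  cv3 (a * x + b * y + c * z) (d * x + e * y + f * z) (g * x + h * y + i * z).
Proof. by apply/colP; apply: ord3P; rewrite !mxE sum3 !mxE. Qed.

Lemma mx3D a b c d e f g h i a' b' c' d' e' f' g' h' i' :
  mx3 a b c d e f g h i + mx3 a' b' c' d' e' f' g' h' i' =
  mx3 (a + a') (b + b') (c + c') (d + d') (e + e') (f + f') (g + g') (h + h')
      (i + i').
Proof. by apply/matrixP; apply: ord3P; apply: ord3P; rewrite !mxE. Qed.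

Lemma mx3Z k a b c d e f g h i :
  k *: mx3 a b c d e f g h i =
  mx3 (k * a) (k * b) (k * c) (k * d) (k * e) (k * f) (k * g) (k * h) (k * i).
Proof. by apply/matrixP; apply: ord3P; apply: ord3P; rewrite !mxE. Qed.

Lemma mx3_scalar k : k%:M = mx3 k 0 0 0 k 0 0 0 k.
Proof. by apply/matrixP; apply: ord3P; apply: ord3P; rewrite !mxE. Qed.

Lemma mx3_tr a b c d e f g h i :
  (mx3 a b c d e f g h i)^T = mx3 a d g b e h c f i.
Proof. by apply/matrixP; apply: ord3P; apply: ord3P; rewrite !mxE. Qed.

Lemma mxtrace_mx3 a b c d e f g h i : \tr (mx3 a b c d e f g h i) = a + e + i.
Proof. by rewrite /mxtrace sum3 !mxE. Qed.

Lemma dotE x y z x' y' z' :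
  dot (cv3 x y z) (cv3 x' y' z') = x * x' + y * y' + z * z'.
Proof. by rewrite /dot !mxE sum3 !mxE. Qed.

Lemma crossE x y z x' y' z' :
  cross (cv3 x y z) (cv3 x' y' z') =
  cv3 (y * z' - z * y') (z * x' - x * z') (x * y' - y * x').
Proof. by rewrite /cross !cv3E. Qed.

Lemma cv3Z k x y z : k *: cv3 x y z = cv3 (k * x) (k * y) (k * z).
Proof. by apply/colP; apply: ord3P; rewrite !mxE. Qed.

Lemma cv3B x y z x' y' z' :
  cv3 x y z - cv3 x' y' z' = cv3 (x - x') (y - y') (z - z').
Proof. by apply/colP; apply: ord3P; rewrite !mxE. Qed.

Lemma dotC X Y : dot X Y = dot Y X.
Proof. by rewrite /dot -[in LHS](trmxK Y) -trmx_mul mxE. Qed.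

Lemma dotZr k X Y : dot X (k *: Y) = k * dot X Y.
Proof. by rewrite /dot -scalemxAr mxE. Qed.

Lemma dotZl k X Y : dot (k *: X) Y = k * dot X Y.
Proof. by rewrite dotC dotZr dotC. Qed.

Lemma dot0r X : dot X 0 = 0.
Proof. by rewrite /dot mulmx0 mxE. Qed.

Lemma dotDr X Y Z : dot X (Y + Z) = dot X Y + dot X Z.
Proof. by rewrite /dot mulmxDr mxE. Qed.

Lemma dot_mulmxl M X Y : dot (M *m X) Y = dot X (M^T *m Y).
Proof. by rewrite /dot trmx_mul mulmxA. Qed.

Lemma dot_sym M X Y : M^T = M -> dot X (M *m Y) = dot Y (M *m X).
Proof. by move=> symM; rewrite dotC dot_mulmxl symM. Qed.

Lemma dot_eq0 X : (forall Y, dot Y X = 0) -> X = 0.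
Proof.
move=> X0; rewrite (cv3_eta X) -cv30; move: (X0 (cv3 1 0 0)) (X0 (cv3 0 1 0)) (X0 (cv3 0 0 1)).
by rewrite [X]cv3_eta !dotE !cv3E !mul0r !mul1r !add0r !addr0 => -> -> ->.
Qed.

Lemma col3_form X Y Z M X' Y' Z' :
  (col3 X Y Z)^T *m M *m col3 X' Y' Z' =
  mx3 (dot X (M *m X')) (dot X (M *m Y')) (dot X (M *m Z'))
      (dot Y (M *m X')) (dot Y (M *m Y')) (dot Y (M *m Z'))
      (dot Z (M *m X')) (dot Z (M *m Y')) (dot Z (M *m Z')).
Proof.
rewrite -mulmxA.
by apply/matrixP; apply: ord3P; apply: ord3P; rewrite /dot !mxE !sum3 !mxE !sum3 !mxE.
Qed.

Lemma col3_trmul X Y Z l : (col3 X Y Z)^T *m l = cv3 (dot X l) (dot Y l) (dot Z l).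
Proof. by apply/colP; apply: ord3P; rewrite /dot !mxE !sum3 !mxE. Qed.

Lemma col3_mulv X Y Z : col3 X Y Z *m cv3 0 1 0 = Y.
Proof.
rewrite /col3 mx3_mulv [RHS]cv3_eta.
by rewrite !mulr0 !mulr1 !add0r !addr0.
Qed.

Lemma proj_eq_refl X : proj_eq X X.
Proof. by exists 1; rewrite ?oner_eq0 ?scale1r. Qed.

Lemma proj_eq_sym X Y : proj_eq X Y -> proj_eq Y X.
Proof.
by case=> k k0 ->; exists k^-1; rewrite ?invr_eq0 // scalerA mulVf // scale1r.
Qed.

Lemma proj_eq_trans Y X Z : proj_eq X Y -> proj_eq Y Z -> proj_eq X Z.
Proof.
case=> k k0 -> [k' k'0 ->]; exists (k * k'); rewrite ?scalerA //.
by rewrite mulf_neq0.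
Qed.

Lemma proj_eq_mul M X Y : proj_eq X Y -> proj_eq (M *m X) (M *m Y).
Proof. by case=> k k0 ->; exists k; rewrite // scalemxAr. Qed.

Lemma proj_eq_mulK M X Y :
  M \in unitmx -> proj_eq (M *m X) (M *m Y) -> proj_eq X Y.
Proof. by move=> uM /(proj_eq_mul (invmx M)); rewrite !mulKmx. Qed.

Lemma unitmx_mul_neq0 M X : M \in unitmx -> X != 0 -> M *m X != 0.
Proof.
by move=> uM; apply: contra => /eqP /(congr1 (mulmx (invmx M))); rewrite mulKmx // mulmx0 => ->.
Qed.

Lemma dot_proj_eq X Y Z : proj_eq Y Z -> dot X Z = 0 -> dot X Y = 0.
Proof. by case=> k _ -> XZ; rewrite dotZr XZ mulr0. Qed.

Lemma dot_proj_eql X Y Z : proj_eq X Y -> dot Y Z = 0 -> dot X Z = 0.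
Proof. by case=> k _ -> YZ; rewrite dotZl YZ mulr0. Qed.

Lemma form_proj_eq M X Y : proj_eq X Y -> dot Y (M *m Y) = 0 -> dot X (M *m X) = 0.
Proof. by case=> k _ -> YY; rewrite -scalemxAr dotZr dotZl YY !mulr0. Qed.

Lemma cross_eq0 X Y : X != 0 -> Y != 0 -> cross X Y = 0 -> proj_eq X Y.
Proof.
have [x [y [z ->]]] := cv3P X; have [x' [y' [z' ->]]] := cv3P Y.
rewrite crossE -cv30 => X0 Y0 /cv3_inj[/eqP e1 /eqP e2 /eqP e3].
move: e1 e2 e3; rewrite !subr_eq0 => /eqP e1 /eqP e2 /eqP e3.
suff [k ek] : exists k, cv3 x y z = k *: cv3 x' y' z'.
  exists k => //; apply: contra X0 => /eqP k0.
  by rewrite ek k0 scale0r cv30.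
have [x'0|x'n0] := eqVneq x' 0; last first.
  exists (x / x'); rewrite cv3Z; congr cv3.
  - by rewrite divfK.
  - by rewrite mulrAC e3 mulfK.
  - by rewrite mulrAC -e2 mulfK.
have [y'0|y'n0] := eqVneq y' 0; last first.
  exists (y / y'); rewrite cv3Z; congr cv3.
  - by rewrite mulrAC -e3 mulfK.
  - by rewrite divfK.
  - by rewrite mulrAC e1 mulfK.
have z'n0 : z' != 0.
  by apply: contra Y0 => /eqP z'0; rewrite x'0 y'0 z'0.
exists (z / z'); rewrite cv3Z; congr cv3.
- by rewrite mulrAC e2 mulfK.
- by rewrite mulrAC -e1 mulfK.
- by rewrite divfK.
Qed.

Lemma proj_eq_cross X Y : proj_eq X Y -> cross X Y = 0.
Proof.
case=> k _ ->; have [x' [y' [z' ->]]] := cv3P Y.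
by rewrite cv3Z crossE -cv30; congr cv3; ring.
Qed.

Lemma proj_eqP X Y : X != 0 -> Y != 0 -> reflect (proj_eq X Y) (cross X Y == 0).
Proof.
move=> X0 Y0; apply: (iffP eqP); [exact: cross_eq0 | exact: proj_eq_cross].
Qed.

Lemma cross_crossl l m X : cross (cross l m) X = dot l X *: m - dot m X *: l.
Proof.
have [x [y [z ->]]] := cv3P X; have [x' [y' [z' ->]]] := cv3P l.
have [x'' [y'' [z'' ->]]] := cv3P m.
by rewrite !crossE !dotE !cv3Z cv3B; congr cv3; ring.
Qed.

Lemma cross_anti X Y : cross Y X = -1 *: cross X Y.
Proof.
have [x [y [z ->]]] := cv3P X; have [x' [y' [z' ->]]] := cv3P Y.
by rewrite !crossE cv3Z; congr cv3; ring.
Qed.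

Lemma dot_crossl X Y : dot X (cross X Y) = 0.
Proof.
have [x [y [z ->]]] := cv3P X; have [x' [y' [z' ->]]] := cv3P Y.
by rewrite !crossE !dotE; ring.
Qed.

Lemma dot_crossr X Y : dot Y (cross X Y) = 0.
Proof.
have [x [y [z ->]]] := cv3P X; have [x' [y' [z' ->]]] := cv3P Y.
by rewrite !crossE !dotE; ring.
Qed.

Lemma common_line l m X Y : l != 0 -> m != 0 -> X != 0 -> Y != 0 ->
  dot l X = 0 -> dot l Y = 0 -> dot m X = 0 -> dot m Y = 0 ->
  proj_eq l m \/ proj_eq X Y.
Proof.
move=> l0 m0 X0 Y0 lX lY mX mY.
have [lm|lm] := eqVneq (cross l m) 0; first by left; apply: cross_eq0.
right; apply: (proj_eq_trans (Y := cross l m)).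
  by apply: proj_eq_sym; apply: cross_eq0; rewrite // cross_crossl lX mX !scale0r subrr.
by apply: cross_eq0; rewrite // cross_crossl lY mY !scale0r subrr.
Qed.

(** The polars of X and Y both pass through X and Y, so the points coincide or the polars do; and
    polarity in a non-degenerate conic is injective. *)
Lemma isotropic_proj_eq M X Y : M^T = M -> M \in unitmx -> X != 0 -> Y != 0 ->
  dot X (M *m X) = 0 -> dot Y (M *m Y) = 0 -> dot X (M *m Y) = 0 ->
  proj_eq X Y.
Proof.
move=> sM uM X0 Y0 XX YY XY.
have := @common_line (M *m X) (M *m Y) X Y.
rewrite !unitmx_mul_neq0 // ![dot (M *m _) _]dotC XX YY XY (dot_sym _ _ sM) XY.
by case=> // /(proj_eq_mulK uM).
Qed.

End Coordinates.

(** * Triangles inscribed in one conic and circumscribed about another *)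

Section Triangles.
Variable K : fieldType.
Implicit Types (G S : 'M[K]_3) (X Y Z l m : 'cV[K]_3).

Lemma sym_entry S i j : S^T = S -> S i j = S j i.
Proof. by move=> {1}<-; rewrite mxE. Qed.

(** A change of basis acts on G by congruence and on the dual conic S contragrediently, so S G is
    merely conjugated. *)
Lemma unitmx_conj_trace (E G S : 'M[K]_3)
    (G1 := E^T *m G *m E) (S1 := invmx E *m S *m (invmx E)^T) :
  E \in unitmx ->
  (\tr (S *m G) = \tr (S1 *m G1)) *
  (\tr (S *m G *m (S *m G)) = \tr (S1 *m G1 *m (S1 *m G1))).
Proof.
move=> uE.
have -> : S1 *m G1 = invmx E *m (S *m G *m E).
  rewrite /S1 /G1 !mulmxA -[X in X *m G](mulmxA (invmx E *m S)).
  by rewrite -trmx_mul mulmxV // trmx1 mulmx1.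
split; first by rewrite [RHS]mxtrace_mulC mulmxK.
rewrite -!mulmxA (mulmxA E) mulmxV // mul1mx [RHS]mxtrace_mulC.
by rewrite -!mulmxA mulmxV // mulmx1.
Qed.

Hypothesis two_neq0 : 2%:R != 0 :> K.

Lemma zero_diag_unitmx (f g h : K) : f != 0 -> g != 0 -> h != 0 ->
  mx3 0 h g h 0 f g f 0 \in unitmx.
Proof.
move=> f0 g0 h0; pose k := (2%:R * f * g * h)^-1.
suff : mx3 0 h g h 0 f g f 0 *m
  (k *: mx3 (- f ^+ 2) (f * g) (f * h) (f * g) (- g ^+ 2) (g * h)
    (f * h) (g * h) (- h ^+ 2)) = 1%:M by case/mulmx1_unit.
rewrite mx3Z mx3_mul mx3_scalar /k.
by congr mx3; field; rewrite f0 g0 h0 two_neq0.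
Qed.

(** Three distinct points of a non-degenerate conic are not collinear: their Gram matrix has zero
    diagonal, non-zero off-diagonal entries f, g, h and determinant 2fgh. *)
Lemma col3_unitmx G X Y Z : G^T = G -> G \in unitmx ->
  X != 0 -> Y != 0 -> Z != 0 ->
  dot X (G *m X) = 0 -> dot Y (G *m Y) = 0 -> dot Z (G *m Z) = 0 ->
  ~ proj_eq X Y -> ~ proj_eq Y Z -> ~ proj_eq X Z ->
  col3 X Y Z \in unitmx.
Proof.
move=> sG uG X0 Y0 Z0 XX YY ZZ XY YZ XZ.
suff : (col3 X Y Z)^T *m G *m col3 X Y Z \in unitmx.
  by rewrite !unitmx_mul => /andP[].
rewrite col3_form XX YY ZZ (dot_sym Y X sG) (dot_sym Z X sG) (dot_sym Z Y sG).
by apply: zero_diag_unitmx; apply/eqP => e;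
  [apply: YZ | apply: XZ | apply: XY]; apply: (isotropic_proj_eq sG uG).
Qed.

(** The third column is the pole of the chord XY. Pairing a linear relation with X and with Y kills
    the coefficients of Y and of X, and the pole is non-zero. *)
Lemma col3_tangent_unitmx G X Y m : G^T = G -> G \in unitmx ->
  X != 0 -> Y != 0 -> m != 0 ->
  dot X (G *m X) = 0 -> dot Y (G *m Y) = 0 -> ~ proj_eq X Y ->
  dot X m = 0 -> dot Y m = 0 ->
  col3 X Y (invmx G *m m) \in unitmx.
Proof.
move=> sG uG X0 Y0 m0 XX YY XY Xm Ym.
rewrite -unitmx_tr unitmxE unitfE; apply/negP => /det0P [v v0 vE].
have {vE} : col3 X Y (invmx G *m m) *m v^T = 0.
  by rewrite -[LHS]trmxK trmx_mul trmxK vE trmx0.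
have {v0} : v^T != 0 by rewrite -trmx0 (inj_eq trmx_inj).
have [p [q [r ->]]] := cv3P v^T => v0.
set N := invmx G *m m => e0.
have GN : G *m N = m by rewrite /N mulKVmx.
have eqn : forall W, p * dot W (G *m X) + q * dot W (G *m Y) + r * dot W m = 0.
  move=> W; have /(congr1 (fun V => dot W (G *m V))) := e0.
  rewrite mulmx0 dot0r => <-; rewrite -GN.
  have -> : col3 X Y N *m cv3 p q r = p *: X + q *: Y + r *: N.
    rewrite /col3 mx3_mulv; apply/colP; apply: ord3P; rewrite !mxE /=; ring.
  by rewrite !mulmxDr !dotDr -!scalemxAr !dotZr.
have gXY : dot X (G *m Y) != 0.
  by apply/eqP => e; apply: XY; apply: (isotropic_proj_eq sG uG).
have q0 : q = 0.
  have := eqn X; rewrite XX Xm !mulr0 add0r addr0 => /eqP.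
  by rewrite mulf_eq0 (negPf gXY) orbF => /eqP.
have p0 : p = 0.
  have := eqn Y; rewrite YY Ym (dot_sym Y X sG) !mulr0 !addr0 => /eqP.
  by rewrite mulf_eq0 (negPf gXY) orbF => /eqP.
have r0 : r = 0.
  apply/eqP; have := m0; apply: contraNT => rn0; apply/eqP/dot_eq0 => W.
  have := eqn W; rewrite p0 q0 !mul0r !add0r => /eqP.
  by rewrite mulf_eq0 (negPf rn0) => /eqP.
by move: v0; rewrite p0 q0 r0 cv30 eqxx.
Qed.

Lemma triangle_trace (f g h f' g' h' : K)
    (M := mx3 0 h' g' h' 0 f' g' f' 0 *m mx3 0 h g h 0 f g f 0) :
  2%:R * \tr (M *m M) = \tr M ^+ 2.
Proof. by rewrite /M !mx3_mul !mxtrace_mx3; ring. Qed.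

Lemma flat_triangle_trace (h k x h' f' : K)
    (M := mx3 x h' 0 h' 0 f' 0 f' 0 *m mx3 0 h 0 h 0 0 0 0 k) :
  2%:R * \tr (M *m M) = \tr M ^+ 2.
Proof. by rewrite /M !mx3_mul !mxtrace_mx3; ring. Qed.

Lemma dual_basis (E : 'M[K]_3) m :
  E \in unitmx -> m = (invmx E)^T *m (E^T *m m).
Proof. by move=> uE; rewrite mulmxA -trmx_mul mulmxV // trmx1 mul1mx. Qed.

Lemma dual_form (E S : 'M[K]_3) m n : E \in unitmx ->
  dot m (S *m n) =
  dot (E^T *m m) (invmx E *m S *m (invmx E)^T *m (E^T *m n)).
Proof.
move=> uE; rewrite {1}(dual_basis m uE) {1}(dual_basis n uE).
by rewrite [LHS]dot_mulmxl trmxK !mulmxA.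
Qed.

(** In the basis of the vertices, G has zero diagonal, and each side is a multiple of a coordinate
    line, so its tangency kills a diagonal entry of S. The trace relation is then an identity. *)
Lemma triangle_condition G S U1 U2 U3 m1 m2 m3 :
  G^T = G -> G \in unitmx -> S^T = S ->
  U1 != 0 -> U2 != 0 -> U3 != 0 -> m1 != 0 -> m2 != 0 -> m3 != 0 ->
  dot U1 (G *m U1) = 0 -> dot U2 (G *m U2) = 0 -> dot U3 (G *m U3) = 0 ->
  ~ proj_eq U1 U2 -> ~ proj_eq U2 U3 -> ~ proj_eq U1 U3 ->
  dot U2 m1 = 0 -> dot U3 m1 = 0 -> dot U3 m2 = 0 -> dot U1 m2 = 0 ->
  dot U1 m3 = 0 -> dot U2 m3 = 0 ->
  dot m1 (S *m m1) = 0 -> dot m2 (S *m m2) = 0 -> dot m3 (S *m m3) = 0 ->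
  2%:R * \tr (S *m G *m (S *m G)) = \tr (S *m G) ^+ 2.
Proof.
move=> sG uG sS U10 U20 U30 m10 m20 m30 U11 U22 U33 U12 U23 U13.
move=> m1U2 m1U3 m2U3 m2U1 m3U1 m3U2 m1S m2S m3S.
have uE := col3_unitmx sG uG U10 U20 U30 U11 U22 U33 U12 U23 U13.
rewrite !(unitmx_conj_trace G S uE).
set E := col3 U1 U2 U3 in uE *.
have -> : E^T *m G *m E = mx3 0 (dot U1 (G *m U2)) (dot U1 (G *m U3))
    (dot U1 (G *m U2)) 0 (dot U2 (G *m U3)) (dot U1 (G *m U3)) (dot U2 (G *m U3)) 0.
  by rewrite col3_form U11 U22 U33 (dot_sym U2 U1 sG) (dot_sym U3 U1 sG)
    (dot_sym U3 U2 sG).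
have dn0 m : m != 0 -> E^T *m m != 0.
  by apply: unitmx_mul_neq0; rewrite unitmx_tr.
move: m1S m2S m3S; rewrite !(dual_form S _ _ uE).
have := dn0 _ m10; have := dn0 _ m20; have := dn0 _ m30.
rewrite !col3_trmul m1U2 m1U3 m2U3 m2U1 m3U1 m3U2 => n3 n2 n1.
set S1 := invmx E *m S *m (invmx E)^T.
have sS1 : S1^T = S1 by rewrite /S1 !trmx_mul trmxK sS mulmxA.
have s10 : S1 1 0 = S1 0 1 by exact: sym_entry.
have s20 : S1 2%:R 0 = S1 0 2%:R by exact: sym_entry.
have s21 : S1 2%:R 1 = S1 1 2%:R by exact: sym_entry.
rewrite (mx3_eta S1) s10 s20 s21 !mx3_mulv !dotE !mul0r !mulr0 !add0r !addr0.
have z (x y : K) : x != 0 -> x * (y * x) = 0 -> y = 0.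
  move=> x0 /eqP; rewrite !mulf_eq0 (negPf x0) orbF /= => /eqP //.
move=> /z -> //; last by apply: contra n1 => /eqP ->; rewrite cv30.
move=> /z -> //; last by apply: contra n2 => /eqP ->; rewrite cv30.
move=> /z -> //; last by apply: contra n3 => /eqP ->; rewrite cv30.
exact: triangle_trace.
Qed.

(** Limit case of a triangle U, U, V: its sides are the tangent n of G at U and the chord m taken
    twice. The double side touches the conic at V, where its two copies meet. *)
Lemma flat_triangle_condition G S U V m n :
  G^T = G -> G \in unitmx -> S^T = S ->
  U != 0 -> V != 0 -> m != 0 -> n != 0 ->
  dot U (G *m U) = 0 -> dot V (G *m V) = 0 -> ~ proj_eq U V ->
  proj_eq n (G *m U) -> dot U m = 0 -> dot V m = 0 ->
  dot n (S *m n) = 0 -> proj_eq (S *m m) V ->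
  2%:R * \tr (S *m G *m (S *m G)) = \tr (S *m G) ^+ 2.
Proof.
move=> sG uG sS U0 V0 m0 n0 UU VV UV nU mU mV nS Sm.
have uE := col3_tangent_unitmx sG uG U0 V0 m0 UU VV UV mU mV.
rewrite !(unitmx_conj_trace G S uE).
set N := invmx G *m m in uE *.
have GN : G *m N = m by rewrite /N mulKVmx.
set E := col3 U V N in uE *.
have -> : E^T *m G *m E = mx3 0 (dot U (G *m V)) 0
    (dot U (G *m V)) 0 0 0 0 (dot N m).
  by rewrite col3_form (dot_sym N U sG) (dot_sym N V sG) !GN mU mV UU VV
    (dot_sym V U sG).
have dn0 l : l != 0 -> E^T *m l != 0.
  by apply: unitmx_mul_neq0; rewrite unitmx_tr.
have Un : dot U n = 0 by apply: dot_proj_eq nU UU.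
have Nn : dot N n = 0.
  by apply: dot_proj_eq nU _; rewrite (dot_sym _ _ sG) GN mU.
move: nS; rewrite !(dual_form S _ _ uE).
have := dn0 _ m0; have := dn0 _ n0.
have : proj_eq (invmx E *m S *m (invmx E)^T *m (E^T *m m)) (cv3 0 1 0).
  apply: (proj_eq_mulK uE); rewrite col3_mulv; apply: proj_eq_trans Sm.
  by rewrite -!mulmxA -(dual_basis m uE) mulKVmx //; apply: proj_eq_refl.
rewrite !col3_trmul mU mV Un Nn.
set S1 := invmx E *m S *m (invmx E)^T.
have sS1 : S1^T = S1 by rewrite /S1 !trmx_mul trmxK sS mulmxA.
have s10 : S1 1 0 = S1 0 1 by exact: sym_entry.
have s20 : S1 2%:R 0 = S1 0 2%:R by exact: sym_entry.
have s21 : S1 2%:R 1 = S1 1 2%:R by exact: sym_entry.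
rewrite (mx3_eta S1) s10 s20 s21 !mx3_mulv !dotE !mul0r !mulr0 !add0r !addr0.
case=> k _; rewrite cv3Z !mulr0 => /cv3_inj[e1 _ e2] nn nm /eqP.
have n1 : dot V n != 0 by apply: contra nn => /eqP ->; rewrite cv30.
have m1 : dot N m != 0 by apply: contra nm => /eqP ->; rewrite cv30.
rewrite !mulf_eq0 (negPf n1) orbF /= => /eqP ->.
move/eqP: e1; rewrite mulf_eq0 (negPf m1) orbF => /eqP ->.
move/eqP: e2; rewrite mulf_eq0 (negPf m1) orbF => /eqP ->.
exact: flat_triangle_trace.
Qed.

End Triangles.

(** Multiplying Cayley-Hamilton by powers of the inverse and taking traces gives a recursion for the
    traces of these powers; those of the second and fourth powers, cleared of denominators, enter
    the hypothesis. *)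
Lemma invmx_square_traces (K : fieldType) (L : 'M[K]_3) (e s d : K)
    (H := invmx L *m invmx L) :
  L *m L *m L + e *: (L *m L) + s *: L + d%:M = 0 ->
  \tr L = - e -> \tr (L *m L) = e ^+ 2 - 2%:R * s ->
  L \in unitmx -> 2%:R * \tr (H *m H) = \tr H ^+ 2 ->
  s * (8%:R * d ^+ 2 - 4%:R * s * e * d + s ^+ 3) = 0.
Proof.
move=> CH trL trL2 uL; set I := invmx L; rewrite /H -/I.
have LI : L *m I = 1%:M by rewrite mulmxV.
have CH1 : L *m L + e *: L + s%:M + d *: I = 0.
  have /(congr1 (mulmx^~ I)) := CH.
  by rewrite !mulmxDl -!scalemxAl -!(mulmxA _ L I) !LI !mulmx1 mul0mx mul_scalar_mx ?scalemx1.
have CH2 : L + e%:M + s *: I + d *: (I *m I) = 0.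
  have /(congr1 (mulmx^~ I)) := CH1.
  by rewrite !mulmxDl -!scalemxAl -!(mulmxA _ L I) !LI !mulmx1 mul0mx mul_scalar_mx ?scalemx1.
have CH3 : 1%:M + e *: I + s *: (I *m I) + d *: (I *m I *m I) = 0.
  have /(congr1 (mulmx^~ I)) := CH2.
  by rewrite !mulmxDl -!scalemxAl !LI mul0mx mul_scalar_mx.
have CH4 : I + e *: (I *m I) + s *: (I *m I *m I)
    + d *: (I *m I *m (I *m I)) = 0.
  have /(congr1 (mulmx^~ I)) := CH3.
  by rewrite !mulmxDl -!scalemxAl mul1mx mul0mx !mulmxA.
have tr1 k : \tr (k%:M : 'M[K]_3) = 3%:R * k by rewrite mxtrace_scalar mulr_natl.
have := congr1 mxtrace CH1; have := congr1 mxtrace CH2.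
have := congr1 mxtrace CH3; have := congr1 mxtrace CH4.
rewrite !mxtraceD !mxtraceZ !tr1 mxtrace0 trL trL2.
set h1 := \tr I; set h2 := \tr (I *m I); set h3 := \tr (I *m I *m I).
set h4 := \tr (I *m I *m (I *m I)).
move=>  E4 E3 E2 E1 hyp.
have t1 : d * h1 = - s.
  by apply/eqP; rewrite -subr_eq0 -E1; apply/eqP; ring.
(* For d = 0 the relation just found gives s = 0. *)
have [d0|d0] := eqVneq d 0.
  by move/eqP: t1; rewrite d0 mul0r eq_sym oppr_eq0 => /eqP ->; rewrite mul0r.
have t2 : d ^+ 2 * h2 = s ^+ 2 - 2%:R * e * d.
  have -> : d ^+ 2 * h2 = d * (d * h2) by ring.
  have -> : d * h2 = - (s * h1 + 2%:R * e).
    by apply/eqP; rewrite -subr_eq0 -E2; apply/eqP; ring.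
  have -> : d * - (s * h1 + 2%:R * e) = - (s * (d * h1) + 2%:R * e * d) by ring.
  by rewrite t1; ring.
have t3 : d ^+ 3 * h3 = - s * (d ^+ 2 * h2) - e * d * (d * h1) - 3%:R * d ^+ 2.
  by apply/eqP; rewrite -subr_eq0 -[X in _ == X](mulr0 (d ^+ 2)) -E3; apply/eqP; ring.
have t4 : d ^+ 4 * h4 = - s * (d ^+ 3 * h3) - e * d * (d ^+ 2 * h2) - d ^+ 2 * (d * h1).
  by apply/eqP; rewrite -subr_eq0 -[X in _ == X](mulr0 (d ^+ 3)) -E4; apply/eqP; ring.
have : 2%:R * (d ^+ 4 * h4) = (d ^+ 2 * h2) ^+ 2.
  by transitivity (d ^+ 4 * (2%:R * h4)); [ring | rewrite hyp; ring].
rewrite t4 t3 t2 t1 => /eqP; rewrite -subr_eq0 => /eqP <-.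
by ring.
Qed.

(** * The operator sending a vertex to the line through its two neighbours *)

Section Diagonals.
Variable K : fieldType.
Hypothesis two_neq0 : 2%:R != 0 :> K.
Variables (x0 y0 A B : K).
Hypotheses (A_neq0 : A != 0) (B_neq0 : B != 0).
Implicit Types (u v w x y l m : 'cV[K]_3).

Definition dualconic : 'M[K]_3 := mx3 A 0 0 0 B 0 0 0 (-1).

(** [inv1] is tr(D G), and X^3 + [inv1] X^2 + [inv2] X + [inv3] is the characteristic polynomial of
    [diagop]. *)
Definition inv1 : K := A + B + 1 - x0 ^+ 2 - y0 ^+ 2.

Definition inv2 : K :=
  4%:R * (A * B + A + B - B * x0 ^+ 2 - A * y0 ^+ 2) - inv1 ^+ 2.

Definition inv3 : K := inv1 * inv2 - 8%:R * A * B.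

Notation G := (unit_circle x0 y0).
Notation D := dualconic.

Definition diagop : 'M[K]_3 := 2%:R *: (D *m G) - inv1%:M.

Definition diagmx : 'M[K]_3 := G *m diagop.

Notation L := diagop.
Notation KK := diagmx.

Lemma unit_circleE : G = mx3 1 0 (- x0) 0 1 (- y0) (- x0) (- y0)
  (x0 ^+ 2 + y0 ^+ 2 - 1).
Proof. by []. Qed.

Lemma diagopE : L = mx3 (2%:R * A - inv1) 0 (- 2%:R * A * x0)
  0 (2%:R * B - inv1) (- 2%:R * B * y0)
  (2%:R * x0) (2%:R * y0) (2%:R * (1 - x0 ^+ 2 - y0 ^+ 2) - inv1).
Proof.
rewrite /diagop unit_circleE /dualconic mx3_mul mx3Z mx3_scalar -scaleN1r mx3Z mx3D.
by congr mx3; ring.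
Qed.

Lemma unit_circle_sym : G^T = G.
Proof. by rewrite unit_circleE mx3_tr. Qed.

Lemma unit_circle_unitmx : G \in unitmx.
Proof.
suff : G *m mx3 (1 - x0 ^+ 2) (- x0 * y0) (- x0) (- x0 * y0) (1 - y0 ^+ 2) (- y0)
  (- x0) (- y0) (-1) = 1%:M by case/mulmx1_unit.
by rewrite unit_circleE mx3_mul mx3_scalar; congr mx3; ring.
Qed.

Lemma dualconic_sym : D^T = D.
Proof. by rewrite mx3_tr. Qed.

Lemma dualconic_unitmx : D \in unitmx.
Proof.
suff : D *m mx3 A^-1 0 0 0 B^-1 0 0 0 (-1) = 1%:M by case/mulmx1_unit.
by rewrite mx3_mul mx3_scalar; congr mx3; field; rewrite ?A_neq0 ?B_neq0.
Qed.

Lemma diagmx_sym : KK^T = KK.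
Proof.
rewrite /diagmx diagopE unit_circleE mx3_mul mx3_tr /inv1.
by congr mx3; ring.
Qed.

(* For x = y, the left-hand side is the equation in x of the pair of tangents drawn
   from v to the conic. For v on G it lies in the pencil spanned by G and by the pair of lines
   (tangent of G at v, line KK v): so KK v joins the two other points where these
   tangents meet G. *)
Lemma tangent_pair_pencil x y v :
  2%:R * dot (cross x v) (D *m cross y v) =
  dot v (KK *m v) * dot x (G *m y) + dot x (KK *m y) * dot v (G *m v)
  - dot x (G *m v) * dot y (KK *m v) - dot y (G *m v) * dot x (KK *m v).
Proof.
have [x1 [x2 [x3 ->]]] := cv3P x; have [y1 [y2 [y3 ->]]] := cv3P y.
have [v1 [v2 [v3 ->]]] := cv3P v.
rewrite /diagmx diagopE unit_circleE mx3_mul !crossE !mx3_mulv !dotE /inv1.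
by ring.
Qed.

(** As 2 is invertible, for v on G the line KK v passes through v exactly when the tangent of G at v
    also touches the other conic. This handles sides with coincident ends. *)
Lemma dot_diagmx v : dot v (G *m v) = 0 ->
  dot v (KK *m v) = 2%:R * dot (G *m v) (D *m (G *m v)).
Proof.
move=> vv; rewrite /diagmx /diagop -mulmxA mulmxBl -scalemxAl mul_scalar_mx.
rewrite mulmxBr -!scalemxAr -[- (inv1 *: _)]scaleNr dotDr !dotZr vv mulr0 addr0.
by rewrite dot_mulmxl unit_circle_sym !mulmxA.
Qed.

(** If KK v vanished, the pencil identity would make every line through v tangent; the lines towards
    the three basis points already force v = 0. *)
Lemma diagmx_neq0 v : v != 0 -> dot v (G *m v) = 0 -> KK *m v != 0.
Proof.
move=> v0 vv; apply/eqP => Kv.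
have T x : dot (cross x v) (D *m cross x v) = 0.
  have := tangent_pair_pencil x x v; rewrite Kv vv !dot0r !mulr0 !mul0r !subr0 addr0.
  by move/eqP; rewrite mulf_eq0 (negPf two_neq0) /= => /eqP.
move: v0 (T (cv3 1 0 0)) (T (cv3 0 1 0)) (T (cv3 0 0 1)) => {vv Kv T}.
have [v1 [v2 [v3 ->]]] := cv3P v.
rewrite !crossE !mx3_mulv !dotE => v0 e1 e2 e3.
have f1 : v2 ^+ 2 = B * v3 ^+ 2.
  by apply/eqP; rewrite -subr_eq0 -oppr_eq0 -e1; apply/eqP; ring.
have f2 : v1 ^+ 2 = A * v3 ^+ 2.
  by apply/eqP; rewrite -subr_eq0 -oppr_eq0 -e2; apply/eqP; ring.
have : 2%:R * A * B * v3 ^+ 2 = A * v2 ^+ 2 + B * v1 ^+ 2.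
  by rewrite f1 f2; ring.
have -> : A * v2 ^+ 2 + B * v1 ^+ 2 = 0 by rewrite -e3; ring.
move/eqP; rewrite !mulf_eq0 (negPf two_neq0) (negPf A_neq0) (negPf B_neq0) /= => /orP v30.
have {}v30 : v3 = 0 by case: v30 => /eqP.
have v10 : v1 = 0 by apply/eqP; rewrite -sqrf_eq0 f2 v30 expr0n mulr0.
have v20 : v2 = 0 by apply/eqP; rewrite -sqrf_eq0 f1 v30 expr0n mulr0.
by move: v0; rewrite v10 v20 v30 cv30 eqxx.
Qed.

Lemma Cayley_Hamilton_diagop :
  L *m L *m L + inv1 *: (L *m L) + inv2 *: L + inv3%:M = 0.
Proof.
rewrite diagopE !mx3_mul !mx3Z mx3_scalar !mx3D /inv3 /inv2 /inv1.
have -> : 0 = mx3 0 0 0 0 0 0 0 0 0 :> 'M[K]_3.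
  by rewrite -mx3_scalar raddf0.
by congr mx3; ring.
Qed.

Lemma mxtrace_diagop : \tr L = - inv1.
Proof. by rewrite diagopE mxtrace_mx3 /inv1; ring. Qed.

Lemma mxtrace_diagop2 : \tr (L *m L) = inv1 ^+ 2 - 2%:R * inv2.
Proof. by rewrite diagopE mx3_mul mxtrace_mx3 /inv2 /inv1; ring. Qed.

Lemma hexagon_invariants (H := invmx L *m invmx L) :
  L \in unitmx -> 2%:R * \tr (H *m H) = \tr H ^+ 2 ->
  inv2 * (8%:R * inv3 ^+ 2 - 4%:R * inv2 * inv1 * inv3 + inv2 ^+ 3) = 0.
Proof.
apply: invmx_square_traces; first exact: Cayley_Hamilton_diagop.
  exact: mxtrace_diagop.
exact: mxtrace_diagop2.
Qed.

End Diagonals.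

(** * The diagonals of a Poncelet hexagon *)

Section Hexagon.
Variable K : fieldType.
Hypothesis two_neq0 : 2%:R != 0 :> K.
Variables (x0 y0 A B : K).
Hypotheses (A_neq0 : A != 0) (B_neq0 : B != 0).
Notation G := (unit_circle x0 y0).
Notation D := (dualconic A B).
Notation L := (diagop x0 y0 A B).
Notation KK := (diagmx x0 y0 A B).

(** The polygon is unrolled along [nat], where neighbours are successors; closure enters later as
    [P_per]. *)
Variables P l : nat -> 'cV[K]_3.
Hypothesis P_neq0 : forall k, P k != 0.
Hypothesis l_neq0 : forall k, l k != 0.
Hypothesis P_on : forall k, dot (P k) (G *m P k) = 0.
Hypothesis lP : forall k, dot (l k) (P k) = 0.
Hypothesis lPS : forall k, dot (l k) (P k.+1) = 0.
Hypothesis l_tangent : forall k, proj_eq (P k) (P k.+1) -> proj_eq (l k) (G *m P k).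
Hypothesis l_dual : forall k, dot (l k) (D *m l k) = 0.
Hypothesis l_contact :
  forall k, proj_eq (l k) (l k.+1) -> proj_eq (D *m l k) (P k.+1).

Let sG := unit_circle_sym x0 y0.
Let uG := unit_circle_unitmx x0 y0.
Let sD := dualconic_sym A B.
Let uD := dualconic_unitmx A_neq0 B_neq0.

(** Three consecutive vertices at X make two successive sides equal to the tangent of G at X, which
    then touches the other conic at X too; from there on vertex and side repeat. This is the
    excluded trivial polygon. *)
Lemma stationary_collapse k :
  proj_eq (P k) (P k.+1) -> proj_eq (P k.+1) (P k.+2) ->
  [/\ proj_eq (l k) (G *m P k.+1), proj_eq (D *m l k) (P k.+1)
    & forall j, proj_eq (P (k.+1 + j)) (P k.+1)].
Proof.
move=> e1 e2; set X := P k.+1.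
have t1 : proj_eq (l k) (G *m X).
  by apply: proj_eq_trans (l_tangent e1) _; apply: proj_eq_mul.
have t2 : proj_eq (l k.+1) (G *m X) by apply: l_tangent.
have c1 : proj_eq (D *m l k) X.
  by apply: l_contact; apply: proj_eq_trans t1 (proj_eq_sym t2).
split=> //.
suff H j : proj_eq (P (k.+1 + j)) X /\ proj_eq (l (k.+1 + j)) (l k).
  by move=> j; case: (H j).
elim: j => [|j [IHP IHl]]; rewrite ?addn0 ?addnS.
  split; first exact: proj_eq_refl.
  by apply: proj_eq_trans t2 (proj_eq_sym t1).
have PX : proj_eq (P (k.+1 + j).+1) X.
  apply: (isotropic_proj_eq sG uG); rewrite /X // -/X.
  have [c _ e] := proj_eq_sym (proj_eq_trans IHl t1).
  by rewrite e dotZr dotC lPS mulr0.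
split=> //; apply: (isotropic_proj_eq sD uD) => //.
apply: dot_proj_eq c1 _; apply: dot_proj_eq (proj_eq_sym PX) _.
exact: lP.
Qed.

Hypothesis nontrivial :
  forall k, ~ (proj_eq (P k) (P k.+1) /\ proj_eq (P k.+1) (P k.+2)).

(** Indexed so that [diag k] joins [P k] to [P k.+2]. *)
Notation diag k := (KK *m P k.+1).

Lemma diag_neq0 k : diag k != 0.
Proof. exact: diagmx_neq0. Qed.

Lemma side_form k : dot (cross (P k) (P k.+1)) (D *m cross (P k) (P k.+1)) = 0.
Proof.
have [e|ne] := eqVneq (cross (P k) (P k.+1)) 0; first by rewrite e mulmx0 dot0r.
apply: form_proj_eq (l_dual k).
have := @common_line _ (cross (P k) (P k.+1)) (l k) (P k) (P k.+1).
case=> //; try (by rewrite dotC ?dot_crossl ?dot_crossr).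
by move/proj_eq_cross => e; rewrite e eqxx in ne.
Qed.

(** With x = y = u the pencil identity leaves only the product of u G v and u KK v, whose first
    factor is non-zero for distinct points of G. *)
Lemma side_diag u v : u != 0 -> v != 0 ->
  dot u (G *m u) = 0 -> dot v (G *m v) = 0 ->
  dot (cross u v) (D *m cross u v) = 0 -> ~ proj_eq u v -> dot u (KK *m v) = 0.
Proof.
move=> u0 v0 uu vv T uv.
have := tangent_pair_pencil x0 y0 A B u u v.
rewrite T uu vv !mulr0 addr0 sub0r -opprD => /eqP; rewrite eq_sym oppr_eq0.
rewrite -mulr2n -mulr_natl !mulf_eq0 (negPf two_neq0) /=.
case/orP => /eqP // e; case: uv.
exact: (isotropic_proj_eq sG uG).
Qed.

Lemma tangent_side_diag u v m : proj_eq u v -> proj_eq m (G *m v) ->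
  dot v (G *m v) = 0 -> dot m (D *m m) = 0 -> dot u (KK *m v) = 0.
Proof.
move=> [k _ ->] mv vv mm; rewrite dotZl dot_diagmx //.
by rewrite (form_proj_eq (proj_eq_sym mv)) // !mulr0.
Qed.

Lemma diagP k : dot (P k) (diag k) = 0.
Proof.
have [/(proj_eqP (P_neq0 k) (P_neq0 k.+1)) e|/(proj_eqP (P_neq0 k) (P_neq0 k.+1)) ne] :=
  boolP (cross (P k) (P k.+1) == 0).
  apply: (@tangent_side_diag _ _ (l k)) => //.
  by apply: proj_eq_trans (l_tangent e) _; apply: proj_eq_mul.
by apply: side_diag => //; apply: side_form.
Qed.

Lemma diagPSS k : dot (P k.+2) (diag k) = 0.
Proof.
have [/(proj_eqP (P_neq0 k.+1) (P_neq0 k.+2)) e|/(proj_eqP (P_neq0 k.+1) (P_neq0 k.+2)) ne] :=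
  boolP (cross (P k.+1) (P k.+2) == 0).
  apply: (@tangent_side_diag _ _ (l k.+1)) => //; first exact: proj_eq_sym.
  exact: l_tangent.
apply: side_diag => //; last by move/proj_eq_sym.
by rewrite cross_anti -scalemxAr dotZl dotZr side_form !mulr0.
Qed.

(** The two sides at [P k.+1] join the same two points, hence coincide, and a double tangent from a
    point touches the conic there. *)
Lemma equal_neighbours k : proj_eq (P k) (P k.+2) ->
  [/\ ~ proj_eq (P k) (P k.+1), proj_eq (l k) (l k.+1)
    & proj_eq (D *m l k) (P k.+1)].
Proof.
move=> e; have ne : ~ proj_eq (P k) (P k.+1).
  move=> e'; apply: (@nontrivial k); split=> //.
  by apply: proj_eq_trans (proj_eq_sym e') e.
have ll : proj_eq (l k) (l k.+1).
  have := @common_line _ (l k) (l k.+1) (P k) (P k.+1).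
  case=> //; rewrite dotC; apply: dot_proj_eql e _.
  by rewrite dotC.
by split=> //; apply: l_contact.
Qed.

(** The side touches the conic at [P k.+1], so the pencil identity with x = [P k] and y free has
    zero left-hand side; what remains makes [diag k] proportional to the polar of [P k]. *)
Lemma diag_tangent k : proj_eq (P k) (P k.+2) -> proj_eq (diag k) (G *m P k).
Proof.
move=> e; have [ne ll con] := equal_neighbours e.
have Pl : proj_eq (cross (P k) (P k.+1)) (l k).
  have := @common_line _ (cross (P k) (P k.+1)) (l k) (P k) (P k.+1).
  case=> //; try (by rewrite dotC ?dot_crossl ?dot_crossr).
  by apply/eqP => /cross_eq0; auto.
have Dv : proj_eq (D *m cross (P k) (P k.+1)) (P k.+1).
  by apply: proj_eq_trans con; apply: proj_eq_mul.
have guv : dot (P k) (G *m P k.+1) != 0.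
  by apply/eqP => e0; apply: ne; apply: (isotropic_proj_eq sG uG).
have vec y : dot (P k) (G *m P k.+1) * dot y (diag k) =
    dot (P k.+1) (diag k) * dot y (G *m P k).
  have := tangent_pair_pencil x0 y0 A B (P k) y (P k.+1).
  rewrite (_ : dot _ (D *m _) = 0); last first.
    rewrite (dot_sym _ _ sD); apply: dot_proj_eq Dv _.
    by rewrite dotC dot_crossr.
  rewrite P_on diagP !mulr0 addr0 subr0 (dot_sym (P k) y sG) => /eqP.
  by rewrite eq_sym subr_eq0 => /eqP.
have eqv : diag k = (dot (P k.+1) (diag k) / dot (P k) (G *m P k.+1)) *: (G *m P k).
  apply/eqP; rewrite -subr_eq0; apply/eqP/dot_eq0 => y.
  rewrite -scaleNr dotDr dotZr mulNr mulrAC -vec mulrAC mulfV // mul1r.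
  by rewrite subrr.
eexists; last exact: eqv.
apply: contraTneq (diag_neq0 k) => e0.
by rewrite eqv e0 scale0r eqxx.
Qed.

(** Otherwise a single side would touch the conic at the distinct points [P k.+1] and [P k.+2]. *)
Lemma no_double_return k :
  ~ (proj_eq (P k) (P k.+2) /\ proj_eq (P k.+1) (P k.+3)).
Proof.
case=> /equal_neighbours[_ ll c1] /equal_neighbours[ne _ c2]; apply: ne.
apply: proj_eq_trans c2; apply: proj_eq_trans (proj_eq_sym c1) _.
exact: proj_eq_mul.
Qed.

Hypothesis P_per : forall k, P k.+4.+2 = P k.

(** By [no_double_return] the other three vertices would be distinct, yet all on the line KK P k.+2,
    while three distinct points of G are never collinear. *)
Lemma not_constant_triple k :
  ~ (proj_eq (P k) (P k.+2) /\ proj_eq (P k.+2) (P k.+4)).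
Proof.
case=> e1 e2.
have e3 : proj_eq (P k.+4) (P k.+4.+2).
  by rewrite P_per; apply: proj_eq_sym; apply: proj_eq_trans e1 e2.
have ne1 : ~ proj_eq (P k.+1) (P k.+3) by move=> e; case: (@no_double_return k).
have ne2 : ~ proj_eq (P k.+3) (P k.+1.+4).
  by move=> e; case: (@no_double_return k.+2).
have ne3 : ~ proj_eq (P k.+1) (P k.+1.+4).
  move=> e; case: (@no_double_return k.+4); split=> //.
  by rewrite (P_per k.+1); apply: proj_eq_sym.
have := @col3_unitmx K two_neq0 G (P k.+1) (P k.+3) (P k.+1.+4) sG uG.
move=> /(_ (P_neq0 _) (P_neq0 _) (P_neq0 _) (P_on _) (P_on _) (P_on _) ne1 ne2 ne3).
rewrite -unitmx_tr => uE.
have := unitmx_mul_neq0 uE (diag_neq0 k.+1); rewrite col3_trmul.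
rewrite diagP diagPSS.
rewrite (_ : dot (P k.+1.+4) (diag k.+1) = 0) ?cv30 ?eqxx //.
apply: dot_proj_eq (diagPSS k.+3).
exact: proj_eq_mul.
Qed.

Definition generic_triple k := [/\ ~ proj_eq (P k) (P k.+2),
  ~ proj_eq (P k.+2) (P k.+4) & ~ proj_eq (P k) (P k.+4)].

(* Two vertices at distance two coincide when the polygon turns back at a common
   point of the conics. *)
Definition flat_triple k := proj_eq (P k) (P k.+2) /\ ~ proj_eq (P k) (P k.+4).

(** The period six rotates the triple of even vertices, so a coincidence of two of them can be moved
    to the front. *)
Lemma triple_cases : generic_triple 0 \/ exists k, flat_triple k.
Proof.
have dec i j : proj_eq (P i) (P j) \/ ~ proj_eq (P i) (P j).
  by case: (proj_eqP (P_neq0 i) (P_neq0 j)); [left | right].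
have := @not_constant_triple 0; rewrite /generic_triple /flat_triple.
have [e02|n02] := dec 0%N 2%N; have [e24|n24] := dec 2%N 4%N; first by case.
- move=> _; right; exists 0%N; split=> // e04; apply: n24.
  by apply: proj_eq_trans e04; apply: proj_eq_sym.
- move=> _; right; exists 2%N; split=> //; rewrite (P_per 0) => e; apply: n02.
  exact: proj_eq_sym.
- move=> _; have [e04|n04] := dec 0%N 4%N; last by left.
  right; exists 4%N; rewrite (P_per 0) (P_per 2); split; first exact: proj_eq_sym.
  by move=> /proj_eq_sym.
Qed.

Lemma generic_basis k : generic_triple k ->
  col3 (P k) (P k.+2) (P k.+4) \in unitmx.
Proof. by case=> *; apply: (col3_unitmx two_neq0 sG uG). Qed.

Lemma flat_diag k : flat_triple k -> dot (P k) (diag k.+2) = 0.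
Proof. by case=> e _; apply: dot_proj_eql e _; apply: diagP. Qed.

Lemma flat_basis k : flat_triple k ->
  col3 (P k) (P k.+4) (invmx G *m diag k.+2) \in unitmx.
Proof.
move=> fk; case: (fk) => _ ne.
apply: (col3_tangent_unitmx sG uG) => //; first exact: diag_neq0.
  exact: flat_diag.
exact: diagPSS.
Qed.

Lemma diagP6 k : dot (P k) (diag k.+4) = 0.
Proof. by rewrite -(P_per k); apply: diagPSS. Qed.

Lemma dot_coords (E : 'M[K]_3) (n m : 'cV[K]_3) : E \in unitmx ->
  dot n m = dot (invmx E *m n) (E^T *m m).
Proof.
by move=> uE; rewrite [RHS]dotC dot_mulmxl trmxK mulKVmx // dotC.
Qed.

(** KK being symmetric, a kernel vector is a point common to all diagonals. The sides of a proper
    triangle have none; in the flat case the tangent at [P k] and the chord meet only in [P k],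
    which KK does not kill. *)
Lemma diagmx_unitmx : KK \in unitmx.
Proof.
rewrite unitmxE unitfE; apply/negP => /det0P [v v0 vK].
have n0 : v^T != 0 by rewrite -trmx0 (inj_eq trmx_inj).
have nK : KK *m v^T = 0.
  by rewrite -[LHS]trmxK trmx_mul trmxK diagmx_sym vK trmx0.
move: v^T n0 nK => {v v0 vK} n n0 nK.
have nd E k : E \in unitmx -> dot (invmx E *m n) (E^T *m diag k) = 0.
  by move=> uE; rewrite -(dot_coords _ _ uE) (dot_sym _ _ (diagmx_sym x0 y0 A B)) nK dot0r.
case: triple_cases => [gk|[k fk]].
  have uE := generic_basis gk.
  have dn0 k : (col3 (P 0) (P 2) (P 4))^T *m diag k != 0.
    by apply: unitmx_mul_neq0; [rewrite unitmx_tr | exact: diag_neq0].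
  have := unitmx_mul_neq0 (M := invmx (col3 (P 0) (P 2) (P 4))).
  move: (nd _ 0%N uE) (nd _ 2%N uE) (nd _ 4%N uE) (dn0 0%N) (dn0 2%N) (dn0 4%N).
  rewrite unitmx_inv !col3_trmul.
  rewrite (diagP 0) (diagPSS 0) (diagP 2) (diagPSS 2) (diagP 4) (diagP6 0).
  have [y1 [y2 [y3 e]]] := cv3P (invmx (col3 (P 0) (P 2) (P 4)) *m n).
  rewrite e !dotE !mulr0 !add0r !addr0 => /eqP + /eqP + /eqP + c0 c2 c4.
  rewrite !mulf_eq0.
  rewrite [X in _ || X](_ : _ = false) ?orbF; last first.
    by apply/eqP => e0; rewrite e0 cv30 eqxx in c0.
  move=> /eqP y30.
  rewrite [X in _ || X](_ : _ = false) ?orbF; last first.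
    by apply/eqP => e0; rewrite e0 cv30 eqxx in c2.
  move=> /eqP y10.
  rewrite [X in _ || X](_ : _ = false) ?orbF; last first.
    by apply/eqP => e0; rewrite e0 cv30 eqxx in c4.
  move=> /eqP y20 /(_ _ uE n0).
  by rewrite e y10 y20 y30 cv30 eqxx.
have uE := flat_basis fk; set E := col3 _ _ _ in uE.
have dn0 j : E^T *m diag j != 0.
  by apply: unitmx_mul_neq0; [rewrite unitmx_tr | exact: diag_neq0].
have [e ne] := fk; have tk := diag_tangent e.
have Nk : dot (invmx G *m diag k.+2) (diag k) = 0.
  apply: dot_proj_eq tk _; rewrite (dot_sym _ _ sG) mulKVmx //.
  exact: flat_diag.
move: (nd _ k uE) (nd _ k.+2 uE) (dn0 k) (dn0 k.+2).
rewrite !col3_trmul Nk diagP flat_diag // diagPSS.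
have [y1 [y2 [y3 ey]]] := cv3P (invmx E *m n).
rewrite ey !dotE !mulr0 !add0r !addr0 => /eqP + /eqP + c0 c2.
rewrite !mulf_eq0.
rewrite [X in _ || X](_ : _ = false) ?orbF; last first.
  by apply/eqP => e0; rewrite e0 cv30 eqxx in c0.
move=> /eqP y20.
rewrite [X in _ || X](_ : _ = false) ?orbF; last first.
  by apply/eqP => e0; rewrite e0 cv30 eqxx in c2.
move=> /eqP y30.
have en : n = y1 *: P k.
  rewrite -(mulKVmx uE n) ey y20 y30 /E /col3 mx3_mulv.
  by rewrite [P k]cv3_eta cv3Z !cv3E; congr cv3; ring.
have y10 : y1 != 0 by apply: contraNneq n0 => y10; rewrite en y10 scale0r.
have := diagmx_neq0 two_neq0 A_neq0 B_neq0 (P_neq0 k) (P_on k).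
move/eqP: nK; rewrite en -scalemxAr scaler_eq0 (negPf y10) /= => /eqP ->.
by rewrite eqxx.
Qed.

Lemma diagop_unitmx : L \in unitmx.
Proof. by have := diagmx_unitmx; rewrite unitmx_mul => /andP[]. Qed.

(* The dual of the conic enveloped by the diagonals. *)
Let S := invmx KK *m G *m invmx KK.

Let S_sym : S^T = S.
Proof. by rewrite /S !trmx_mul trmx_inv diagmx_sym sG mulmxA. Qed.

Let SG : S *m G = invmx L *m invmx L.
Proof.
rewrite /S; have -> : invmx KK = invmx L *m invmx G.
  rewrite -[RHS](mulKmx diagmx_unitmx) /diagmx -(mulmxA G L).
  by rewrite (mulKVmx diagop_unitmx) mulmxV // mulmx1.
by rewrite -!mulmxA (mulmxA (invmx G) G) mulVmx // mul1mx mulmx1.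
Qed.

Let S_diag k : S *m diag k = invmx KK *m (G *m P k.+1).
Proof.
rewrite /S -(mulmxA (invmx KK *m G) (invmx KK)) mulKmx ?diagmx_unitmx //.
by rewrite -mulmxA.
Qed.

Let S_tangent k : dot (diag k) (S *m diag k) = 0.
Proof.
by rewrite S_diag dot_mulmxl diagmx_sym mulKVmx ?diagmx_unitmx.
Qed.

Lemma hexagon_condition (s := inv2 x0 y0 A B) (d := inv3 x0 y0 A B)
    (e := inv1 x0 y0 A B) :
  s * (8%:R * d ^+ 2 - 4%:R * s * e * d + s ^+ 3) = 0.
Proof.
apply: (hexagon_invariants diagop_unitmx); rewrite -SG.
case: triple_cases => [[n1 n2 n3]|[k fk]].
  (* The sides opposite to [P 0], [P 2], [P 4] are [diag 2], [diag 4], [diag 0]. *)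
  apply: (triangle_condition two_neq0 sG uG S_sym (P_neq0 0) (P_neq0 2) (P_neq0 4)
    (diag_neq0 2) (diag_neq0 4) (diag_neq0 0)) => //; try exact: diagP; try exact: diagPSS.
  exact: diagP6.
have [ek nek] := fk.
apply: (@flat_triangle_condition _ G S (P k) (P k.+4) (diag k.+2) (diag k)) => //;
  try exact: diag_neq0; try exact: diagPSS; try exact: S_tangent.
- exact: diag_tangent.
- exact: flat_diag.
(* The double side [diag k.+2] must touch at [P k.+4]. It joins the same two points as [diag k.+4],
   so injectivity of KK identifies [P k.+3] with [P k.+3.+2], and KK P k.+4 is then the tangent of G
   at [P k.+3]. *)
rewrite S_diag; have e35 : proj_eq (P k.+3) (P k.+3.+2).
  apply: (proj_eq_mulK diagmx_unitmx).
  have := @common_line _ (diag k.+2) (diag k.+4) (P k) (P k.+4).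
  case=> //; try exact: diag_neq0; rewrite dotC.
  - exact: flat_diag.
  - exact: diagPSS.
  - exact: diagP6.
  - exact: diagP.
rewrite -[X in proj_eq _ X](mulKmx diagmx_unitmx).
by apply: proj_eq_mul; apply: proj_eq_sym; apply: diag_tangent.
Qed.

End Hexagon.

(** * Confocal conics in dual form and the necessary condition on t *)

Section ConfocalConics.
Variable K : fieldType.
Implicit Types (M : 'M[K]_3) (X l : 'cV[K]_3).

Lemma on_conicP M X : on_conic M X <-> dot X (M *m X) = 0.
Proof.
rewrite /on_conic /dot mulmxA; split=> [->|e]; first by rewrite mxE.
by apply/matrixP => i j; rewrite !ord1 e mxE.
Qed.

Lemma incidentP X l : incident X l <-> dot l X = 0.
Proof.
rewrite /incident /dot; split=> [->|e]; first by rewrite mxE.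
by apply/matrixP => i j; rewrite !ord1 e mxE.
Qed.

Variables a b t : K.
Hypotheses (at0 : a - t != 0) (bt0 : b - t != 0).
Notation C := (confocal_conic a b t).
Notation D := (dualconic (a - t) (b - t)).

Lemma confocal_conicE : C = mx3 (a - t)^-1 0 0 0 (b - t)^-1 0 0 0 (-1).
Proof.
by apply/matrixP; apply: ord3P; apply: ord3P; rewrite !mxE.
Qed.

Lemma confocal_dualK : D *m C = 1%:M.
Proof.
rewrite confocal_conicE mx3_mul mx3_scalar.
by congr mx3; field; rewrite ?at0 ?bt0.
Qed.

(** D is inverse to the matrix of the conic, so a tangent l has contact point D l. *)
Lemma tangent_atP l X :
  tangent_at C l X <-> [/\ X != 0, dot l (D *m l) = 0 & proj_eq (D *m l) X].
Proof.
have CD := mulmx1C confocal_dualK.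
have sC : C^T = C by rewrite confocal_conicE mx3_tr.
split=> [[X0 /on_conicP XX lX]|[X0 ll lX]].
  have DX : proj_eq (D *m l) X.
    by rewrite -[X in proj_eq _ X]mul1mx -confocal_dualK -mulmxA; apply: proj_eq_mul.
  split=> //; apply: dot_proj_eq DX _; apply: dot_proj_eql lX _.
  by rewrite dotC.
have lC : proj_eq l (C *m X).
  by rewrite -[X in proj_eq X _]mul1mx -CD -mulmxA; apply: proj_eq_mul.
split=> //; apply/on_conicP; apply: dot_proj_eq (proj_eq_sym lC) _.
by apply: dot_proj_eql (proj_eq_sym lX) _; rewrite dotC.
Qed.

Lemma tangentP l : l != 0 -> (tangent C l <-> dot l (D *m l) = 0).
Proof.
move=> l0; split=> [[X /tangent_atP[]] //|ll].
exists (D *m l); apply/tangent_atP; split=> //; last exact: proj_eq_refl.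
by apply: unitmx_mul_neq0; rewrite ?dualconic_unitmx.
Qed.

Lemma iter_ordS6 j (i : 'I_6) : iter (6 * j) (@ordS 6) i = i.
Proof.
elim: j => // j IHj; rewrite mulnS iterD IHj.
by apply: val_inj; move: i {IHj} => [[|[|[|[|[|[|]]]]]] lti].
Qed.

Lemma iter_ordS_ord0 (i : 'I_6) : iter i (@ordS 6) (ord0 : 'I_6) = i.
Proof. by apply: val_inj; move: i => [[|[|[|[|[|[|]]]]]] lti]. Qed.

Lemma poncelet_pair6_condition (x0 y0 : K) (s := inv2 x0 y0 (a - t) (b - t))
    (d := inv3 x0 y0 (a - t) (b - t)) (e := inv1 x0 y0 (a - t) (b - t)) :
  2%:R != 0 :> K -> poncelet_pair 6 (unit_circle x0 y0) C ->
  s * (8%:R * d ^+ 2 - 4%:R * s * e * d + s ^+ 3) = 0.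
Proof.
move=> two_neq0 [P [l [[P0 l0 meets tang] nontriv]]].
pose i_ k := iter k (@ordS 6) (ord0 : 'I_6).
pose Q k := P (i_ k); pose m k := l (i_ k).
have Q0 k : Q k != 0 by apply: P0.
have m0 k : m k != 0 by apply: l0.
have Qon k : dot (Q k) (unit_circle x0 y0 *m Q k) = 0.
  by case: (meets (i_ k)) => /on_conicP.
have mQ k : dot (m k) (Q k) = 0 by case: (meets (i_ k)) => _ _ /incidentP.
have mQS k : dot (m k) (Q k.+1) = 0 by case: (meets (i_ k)) => _ _ _ /incidentP.
have mtan k : proj_eq (Q k) (Q k.+1) -> proj_eq (m k) (unit_circle x0 y0 *m Q k).
  by case: (meets (i_ k)) => _ _ _ _ h /h[].
have mdual k : dot (m k) (D *m m k) = 0.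
  by case: (tang (i_ k)) => /(tangentP (m0 k)).
have mcon k : proj_eq (m k) (m k.+1) -> proj_eq (D *m m k) (Q k.+1).
  by case: (tang (i_ k)) => _ _ _ _ h /h /tangent_atP[].
have Qper k : Q k.+4.+2 = Q k.
  by rewrite /Q /i_ (iterD 6) (iter_ordS6 1).
apply: (hexagon_condition two_neq0 at0 bt0 Q0 m0 Qon mQ mQS mtan mdual mcon _ Qper).
move=> k [e1 e2].
have [tG tC coll] := stationary_collapse at0 bt0 Q0 m0 Qon mQ mQS mtan mdual mcon e1 e2.
apply: nontriv; exists (Q k.+1).
  exists (m k); split; first by split=> //; apply/on_conicP.
  exact/tangent_atP.
(* From position k + 1, another 5(k + 1) + i steps lead to 6(k + 1) + i, which is i modulo 6. *)
move=> i; have := coll (5 * k.+1 + i)%N.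
rewrite /Q /i_ addnA -mulSn iterD iter_ordS_ord0.
by rewrite iter_ordS6.
Qed.

End ConfocalConics.

(** * A hexagon shared by the whole confocal family *)

Section IsotropicHexagon.
Variables (K : fieldType) (a b c t i : K).
Hypotheses (two_neq0 : 2%:R != 0 :> K) (i2 : i ^+ 2 = -1).
Hypotheses (at0 : a - t != 0) (bt0 : b - t != 0).
Hypotheses (abc : a - b = c ^+ 2) (c4 : 4%:R * c ^+ 2 = 1).
Notation C := (confocal_conic a b t).
Notation G := (unit_circle (- c) 0).

Let c_neq0 : c != 0.
Proof.
by apply/eqP => c0; move/eqP: c4; rewrite c0 expr0n mulr0 eq_sym oner_eq0.
Qed.

(** [F] is the focus on the circle and [J j], for j^2 = -1, a circular point at infinity; [focal j]
    and [central j] join [J j] to [F] and to the other focus (-c, 0), the centre. *)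
Let F := cv3 c 0 1.
Let J (j : K) := cv3 1 j 0.
Let focal (j : K) := cv3 1 j (- c).
Let central (j : K) := cv3 1 j c.

Let cv3_neq0 (x y z : K) : (x != 0) || (z != 0) -> cv3 x y z != 0.
Proof.
move=> xz; apply/eqP; rewrite -cv30 => /cv3_inj[x0 _ z0].
by move: xz; rewrite x0 z0 eqxx.
Qed.

Let G_circle j : j ^+ 2 = -1 -> on_conic G (J j).
Proof.
by move=> j2; apply/on_conicP; rewrite unit_circleE mx3_mulv dotE; ring: j2.
Qed.

Let G_focus : on_conic G F.
Proof. by apply/on_conicP; rewrite unit_circleE mx3_mulv dotE; ring: c4. Qed.

(** The dual form at this line is (a - t) - (b - t) - c^2, which vanishes whatever t is. *)
Let focal_tangent j : j ^+ 2 = -1 -> tangent C (focal j).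
Proof.
move=> j2; apply/tangentP => //; first by apply: cv3_neq0; rewrite oner_eq0.
have -> : a - t = b - t + c ^+ 2 by rewrite -abc; ring.
by rewrite mx3_mulv dotE; ring: j2.
Qed.

Let central_tangent j : j ^+ 2 = -1 -> tangent C (central j).
Proof.
move=> j2; apply/tangentP => //; first by apply: cv3_neq0; rewrite oner_eq0.
have -> : a - t = b - t + c ^+ 2 by rewrite -abc; ring.
by rewrite mx3_mulv dotE; ring: j2.
Qed.

Let J_focal j : j ^+ 2 = -1 -> incident (J j) (focal j).
Proof. by move=> j2; apply/incidentP; rewrite dotE; ring: j2. Qed.

Let J_central j : j ^+ 2 = -1 -> incident (J j) (central j).
Proof. by move=> j2; apply/incidentP; rewrite dotE; ring: j2. Qed.

Let F_focal j : incident F (focal j).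
Proof. by apply/incidentP; rewrite dotE; ring. Qed.

Let F_J j : ~ proj_eq F (J j).
Proof.
by case=> k _; rewrite cv3Z => /cv3_inj[_ _ /eqP]; rewrite mulr0 oner_eq0.
Qed.

Let focal_central j : ~ proj_eq (focal j) (central j).
Proof.
case=> k _; rewrite cv3Z mulr1 => /cv3_inj[<- _ /eqP].
rewrite mul1r eq_sym -addr_eq0 -mulr2n -mulr_natl mulf_eq0.
by rewrite (negPf two_neq0) (negPf c_neq0).
Qed.

Let focal_focal j : j ^+ 2 = -1 -> ~ proj_eq (focal j) (focal (- j)).
Proof.
move=> j2 [k _]; rewrite cv3Z mulr1 => /cv3_inj[<- /eqP + _].
rewrite mul1r -addr_eq0 -mulr2n -mulr_natl mulf_eq0 (negPf two_neq0) /=.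
by rewrite -sqrf_eq0 j2 oppr_eq0 oner_eq0.
Qed.

Let F_J_side j : j ^+ 2 = -1 ->
  line_meets G (focal j) F (J j) /\ line_meets G (focal j) (J j) F.
Proof.
move=> j2; split; split; auto.
  by move/F_J.
by move/proj_eq_sym/F_J.
Qed.

Let J_J_side j : j ^+ 2 = -1 -> line_meets G (central j) (J j) (J j).
Proof.
move=> j2; split; auto; split; auto.
  by apply: cv3_neq0; rewrite oner_eq0.
rewrite unit_circleE mx3_mulv; exists 1; rewrite ?oner_eq0 // scale1r.
by congr cv3; ring.
Qed.

Let J_vertex j : j ^+ 2 = -1 ->
  tangents_from C (J j) (focal j) (central j) /\
  tangents_from C (J j) (central j) (focal j).
Proof.
move=> j2; split; split; auto.
  by move/focal_central.
by move/proj_eq_sym/focal_central.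
Qed.

Let F_vertex j : j ^+ 2 = -1 -> tangents_from C F (focal j) (focal (- j)).
Proof.
move=> j2; have j2' : (- j) ^+ 2 = -1 by rewrite sqrrN.
by split; auto; move/focal_focal.
Qed.

(* The vertices are the focus on the circle and the circular points; the sides are
   the isotropic lines through the foci, which touch every confocal conic. Those through
   the centre of the circle are tangent to it. *)
Lemma isotropic_hexagon : poncelet_pair 6 G C.
Proof.
have i2' : (- i) ^+ 2 = -1 by rewrite sqrrN.
exists (fun k : 'I_6 => nth 0 [:: F; J i; J i; F; J (- i); J (- i)] k).
exists (fun k : 'I_6 => nth 0 [:: focal i; central i; focal i;
  focal (- i); central (- i); focal (- i)] k).
split; last first.
  case=> X _ eX; have := proj_eq_trans (eX ord0) (proj_eq_sym (eX (ordS ord0))).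
  exact: F_J.
have o1 : 1 != 0 :> K by rewrite oner_eq0.
split=> [] [[|[|[|[|[|[|]]]]]] lti] //=; try (by apply: cv3_neq0; rewrite o1 ?orbT).
- by case: (F_J_side i2).
- exact: J_J_side.
- by case: (F_J_side i2).
- by case: (F_J_side i2').
- exact: J_J_side.
- by case: (F_J_side i2').
- by case: (J_vertex i2).
- by case: (J_vertex i2).
- exact: F_vertex.
- by case: (J_vertex i2').
- by case: (J_vertex i2').
- by rewrite -[X in tangents_from _ _ _ (focal X)]opprK; apply: F_vertex.
Qed.

End IsotropicHexagon.

(** * Solving the condition for all real t below b *)

Lemma cubic_eq0 (R : realFieldType) (c3 c2 c1 c0 n : R) :
  (forall T, n <= T -> c3 * T ^+ 3 + c2 * T ^+ 2 + c1 * T + c0 = 0) ->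
  [/\ c3 = 0, c2 = 0, c1 = 0 & c0 = 0].
Proof.
move=> H.
pose p T := c3 * T ^+ 3 + c2 * T ^+ 2 + c1 * T + c0.
have p0 : p n = 0 by apply: H.
have p1 : p (n + 1) = 0 by apply: H; lra.
have p2 : p (n + 2%:R) = 0 by apply: H; lra.
have p3 : p (n + 3%:R) = 0 by apply: H; lra.
(* Finite differences of orders 3, 2 and 1 at n isolate the coefficients in turn. *)
have c30 : c3 = 0.
  have : 6%:R * c3 = p (n + 3%:R) - 3%:R * p (n + 2%:R) + 3%:R * p (n + 1) - p n.
    by rewrite /p; ring.
  by rewrite p0 p1 p2 p3; lra.
have c20 : c2 = 0.
  have : 2%:R * c2 = p (n + 2%:R) - 2%:R * p (n + 1) + p n.
    by rewrite /p c30; ring.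
  by rewrite p0 p1 p2; lra.
have c10 : c1 = 0.
  have : c1 = p (n + 1) - p n by rewrite /p c30 c20; ring.
  by rewrite p0 p1 subrr.
by split=> //; rewrite -p0 /p c30 c20 c10; ring.
Qed.

Lemma hexagon_family_solve (R : realFieldType) (a b x0 y0 : R) : b < a ->
  (forall t, t < b ->
    let e := inv1 x0 y0 (a - t) (b - t) in
    let s := inv2 x0 y0 (a - t) (b - t) in
    let d := inv3 x0 y0 (a - t) (b - t) in
    s * (8%:R * d ^+ 2 - 4%:R * s * e * d + s ^+ 3) = 0) ->
  [/\ 4%:R * (a - b) = 1, y0 = 0 & 4%:R * x0 ^+ 2 = 1].
Proof.
move=> ab H.
(* With T = (a + b)/2 - t, the numbers a - t and b - t become T + h and T - h, and the three
   invariants become 2 T + r, 4 T + q and [al] T + [be]. *)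
pose h := (a - b) / 2%:R; have h0 : 0 < h by rewrite /h; lra.
pose r := 1 - x0 ^+ 2 - y0 ^+ 2.
pose q := 4%:R * h * (x0 ^+ 2 - y0 ^+ 2) - 4%:R * h ^+ 2 - r ^+ 2.
pose al := 2%:R * q + 4%:R * r; pose be := r * q + 8%:R * h ^+ 2.
(* These are the coefficients in T of 8 d^2 - 4 s e d + s^3. *)
have [c3 c2 c1 c0] : [/\ 64%:R - 32%:R * al = 0,
    8%:R * al ^+ 2 - 4%:R * (al ^+ 2 + 8%:R * be) + 48%:R * q = 0,
    16%:R * al * be - 4%:R * (al * be + r * q * al) + 12%:R * q ^+ 2 = 0
    & 8%:R * be ^+ 2 - 4%:R * r * q * be + q ^+ 3 = 0].
  (* The bound ensures T > h, hence t < b, and T > |q|, hence s = 4 T + q is non-zero and can be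
     cancelled. *)
  apply: (@cubic_eq0 _ _ _ _ _ (h + `|q| + 1)) => T hT.
  have q1 := ler_norm q; have q2 := ler_norm (- q); rewrite normrN in q2.
  pose t := (a + b) / 2%:R - T.
  have tb : t < b by rewrite /t; rewrite /h in hT; lra.
  have Ea : a - t = T + h by rewrite /t /h; field.
  have Eb : b - t = T - h by rewrite /t /h; field.
  have := H t tb; rewrite Ea Eb /=.
  have -> : inv3 x0 y0 (T + h) (T - h) = al * T + be.
    by rewrite /inv3 /inv2 /inv1 /al /be /q /r; ring.
  have -> : inv2 x0 y0 (T + h) (T - h) = 4%:R * T + q.
    by rewrite /inv2 /inv1 /q /r; ring.
  have -> : inv1 x0 y0 (T + h) (T - h) = 2%:R * T + r.
    by rewrite /inv1 /r; ring.
  have s0 : 4%:R * T + q != 0 by apply/eqP => e; lra.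
  move/eqP; rewrite mulf_eq0 (negPf s0) /= => /eqP <-.
  by rewrite /al; ring.
have q_eq : q = 1 - 2%:R * r by rewrite /al in c3; lra.
have al2 : al = 2%:R by lra.
have be_eq : be = 2%:R - 3%:R * r by rewrite al2 in c2; lra.
(* Once [al], [be] and q are substituted, the linear coefficient is 4(16 r^2 - 32 r + 15). *)
have : (4%:R * r - 3%:R) * (4%:R * r - 5%:R) = 0.
  have -> : (4%:R * r - 3%:R) * (4%:R * r - 5%:R) = 
    6%:R * be - 2%:R * r * q + 3%:R * q ^+ 2 by rewrite be_eq q_eq; ring.
  by rewrite al2 in c1; lra.
have x2 := sqr_ge0 x0; have y2 := sqr_ge0 y0.
(* For real x0 and y0, r is at most 1, which excludes r = 5/4. *)
have -> : 4%:R * r - 5%:R = - (4%:R * x0 ^+ 2 + 4%:R * y0 ^+ 2 + 1) by rewrite /r; ring.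
move=> /eqP; rewrite mulf_eq0 oppr_eq0 => /orP[/eqP er|/eqP]; last by lra.
have r34 : r = 3%:R / 4%:R by lra.
have h2 : h ^+ 2 = 1 / 64%:R.
  by move: be_eq; rewrite /be q_eq r34; lra.
have h8 : h = 1 / 8%:R.
  have : (h - 1 / 8%:R) * (h + 1 / 8%:R) = 0.
    have -> : (h - 1 / 8%:R) * (h + 1 / 8%:R) = h ^+ 2 - 1 / 64%:R by field.
    by rewrite h2 subrr.
  by move/eqP; rewrite mulf_eq0 => /orP[] /eqP; lra.
have del : x0 ^+ 2 - y0 ^+ 2 = 1 / 4%:R.
  by move: q_eq; rewrite /q h8 r34; lra.
have rr : 1 - x0 ^+ 2 - y0 ^+ 2 = 3%:R / 4%:R by [].
split; first by move: h8; rewrite /h; lra.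
  by apply/eqP; rewrite -sqrf_eq0; apply/eqP; lra.
by lra.
Qed.

(** * The equivalence over the complex numbers *)

Theorem theorem3p7 (R : realType) (a b x0 y0 : R) (hab : b < a) (hb : 0 < b) :
  let G := unit_circle x0%:C y0%:C in
  let c := Num.sqrt (a - b) in
  let F1 := affine_point c%:C 0 in
  let F2 := affine_point (- c)%:C 0 in
  (forall t : R[i], t != a%:C -> t != b%:C ->
     poncelet_pair 6 G (confocal_conic a%:C b%:C t))
  <->
  (on_conic G F1 /\ (x0, y0) = (- c, 0)) \/
  (on_conic G F2 /\ (x0, y0) = (c, 0)).
Proof.
have two_neq0 : 2%:R != 0 :> R[i] by rewrite pnatr_eq0.
have c2 : Num.sqrt (a - b) ^+ 2 = a - b by rewrite sqr_sqrtr // subr_ge0 ltW.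
have c_ge0 := sqrtr_ge0 (a - b).
move=> G c F1 F2; rewrite -/c in c2 c_ge0; split=> [pair|].
  (* Real parameters t < b suffice here: the relation obtained in [R[i]] descends to R because the
     embedding is injective. *)
  have [c4 y00 x04] : [/\ 4%:R * (a - b) = 1, y0 = 0 & 4%:R * x0 ^+ 2 = 1].
    apply: hexagon_family_solve => // t tb e s d.
    have ta : t%:C != a%:C by rewrite (inj_eq (@complexI _)) lt_eqF // (lt_trans tb).
    have tb' : t%:C != b%:C by rewrite (inj_eq (@complexI _)) lt_eqF.
    have := poncelet_pair6_condition _ _ two_neq0 (pair _ ta tb').
    rewrite !subr_eq0 ![_%:C == t%:C]eq_sym => /(_ ta tb').
    rewrite /inv3 /inv2 /inv1 => H; apply: complexI.
    rewrite -[RHS]H /s /d /e /inv3 /inv2 /inv1.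
    by rewrite !(rmorph_nat, rmorph1, rmorphN, rmorphD, rmorphM, rmorphXn).
  have on (k : R) : 4%:R * k ^+ 2 = 1 ->
      on_conic (unit_circle (- k)%:C 0%:C) (affine_point k%:C 0).
    move=> k4; apply/on_unit_circleE; rewrite rmorphN rmorph0.
    have := congr1 (real_complex R) k4.
    by rewrite rmorphM rmorphXn rmorph_nat rmorph1 => <-; ring.
  have xc : x0 ^+ 2 = c ^+ 2 by lra.
  rewrite /G /F1 /F2 y00; move/eqP: xc; rewrite eqf_sqr => /orP[]/eqP xc.
    right; rewrite -[in unit_circle _ _](opprK x0) -xc; split=> //.
    by apply: on; rewrite sqrrN.
  left; rewrite xc; split=> //.
  by apply: on; rewrite c2.
(* The two cases are k = c and k = -c; the relation 4 k^2 = 1 is read off the equation of the circle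
   at (k, 0). *)
have conv (k : R) : k ^+ 2 = c ^+ 2 ->
    on_conic (unit_circle (- k)%:C 0%:C) (affine_point k%:C 0) ->
    forall t : R[i], t != a%:C -> t != b%:C ->
    poncelet_pair 6 (unit_circle (- k)%:C 0%:C) (confocal_conic a%:C b%:C t).
  move=> k2 /on_unit_circleE e t ta tb.
  rewrite rmorphN rmorph0 in e *.
  apply: (@isotropic_hexagon _ _ _ _ _ 'i) => //.
  - by rewrite sqr_i.
  - by rewrite subr_eq0 eq_sym.
  - by rewrite subr_eq0 eq_sym.
  - by rewrite -rmorphB -rmorphXn k2 c2.
  - by rewrite -[RHS]e; ring.
case=> -[on [ex ey]]; rewrite /G /F1 /F2 ex ey in on *.
  exact: conv.
rewrite -[X in unit_circle X%:C](opprK c) in on *; apply: conv => //.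
by rewrite sqrrN.
Qed.
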